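(* Let $\mathcal P_\Theta=\{p(x,\theta)\,dx:\theta\in\Theta\}$ be an exponential family, i.e. $p(x,\theta)=\exp\big(h(x)+\theta\cdot\varphi(x)-F(\theta)\big)$. Assume that the Fisher--Rao metric on $\Theta$ is not flat and that $\dim\Theta=2$. Then: (1) If $\alpha=1$, then $\nabla^{(\alpha)}$ is the Levi-Civita connection of the Euclidean metric on $\Theta$. (2) If $\alpha=0$, then $\nabla^{(\alpha)}$ is the Levi-Civita connection of the Fisher--Rao metric. (3) If $\alpha=-1$, then $\nabla^{(\alpha)}$ is the Levi-Civita connection of the metric $G^{(-1)}(\theta)=(\mathrm{Hess}_\theta F)^2$. (4) If $\alpha\notin\{1,0,-1\}$, then $\nabla^{(\alpha)}$ is a non-metric affine connection, i.e. there is no Riemannian metric on $\Theta$ with which $\nabla^{(\alpha)}$ is compatible.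
   Context: $\mathcal P_\Theta$ is a parametric family of probability densities on $\mathbb R^n$, where $x\in\mathbb R^n$ is the sample variable, $dx$ is the Lebesgue measure, and $\theta$ ranges over the parameter space $\Theta\subset\mathbb R^d$ (open, with $d=\dim\Theta$). It is an exponential family with natural parameter $\theta$ if its density has the form above for certain functions $h$ and $\varphi$ on $\mathbb R^n$ (real- and $\mathbb R^d$-valued, respectively) and $F$ on $\Theta$. The usual regularity of statistical models is assumed: smoothness in $\theta$, differentiation under the integral sign, and positive definiteness of the Fisher--Rao metric. Write $\ell(x,\theta)=\log p(x,\theta)$, $\partial_i=\partial/\partial\theta^i$, and $E_\theta$ for expectation with respect to $p(\cdot,\theta)$. The Fisher--Rao metric on $\Theta$ is $$G_{ij}(\theta)=E_\theta\left[\partial_i\ell(X,\theta)\,\partial_j\ell(X,\theta)\right],$$ and the $\alpha$-connection $\nabla^{(\alpha)}$ on $\Theta$ is the affine connection defined by $$\Gamma^{(\alpha)}_{ij,k}(\theta)=G_\theta(\nabla^{(\alpha)}_{\partial_i}\partial_j,\partial_k)=E_\theta\left[\left(\partial_i\partial_j\ell(X,\theta)+\frac{1-\alpha}{2}\partial_i\ell(X,\theta)\,\partial_j\ell(X,\theta)\right)\partial_k\ell(X,\theta)\right].$$ ''Not flat'' means that the Riemann curvature tensor of the Fisher--Rao metric is not identically zero. $\mathrm{Hess}_\theta F$ is the Hessian matrix of $F$ at $\theta$, and $(\mathrm{Hess}_\theta F)^2$ is its matrix square, viewed as a metric via $(u,v)\mapsto u^\top(\mathrm{Hess}_\theta F)^2v$.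 A connection $\nabla$ is compatible with a metric $g$ if $X g(Y,Z)=g(\nabla_XY,Z)+g(Y,\nabla_XZ)$ for all vector fields $X,Y,Z$. *)

(* Defs.v *)
From HB Require Import structures.
From mathcomp Require Import all_boot all_order all_algebra.
From mathcomp Require Import all_classical all_reals all_analysis.

Set Implicit Arguments.
Unset Strict Implicit.
Unset Printing Implicit Defensive.

Import Order.TTheory GRing.Theory Num.Theory.
Import numFieldNormedType.Exports.

Local Open Scope classical_set_scope.
Local Open Scope ring_scope.

(* The sample space R^n is [n.-tuple (measurableTypeR R)], which the library
   equips with the product (Borel) sigma-algebra; the parameter space is
   contained in ['rV[R]_d], which carries the topology and norm of R^d. *)
Notation sample R n := (n.-tuple (measurableTypeR R)).

Definition cons_pair (R : realType) (n : nat)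
    (z : measurableTypeR R * sample R n) : sample R n.+1 :=
  [tuple of z.1 :: z.2].

Lemma measurable_cons_pair (R : realType) (n : nat) :
  measurable_fun [set: measurableTypeR R * sample R n] (@cons_pair R n).
Proof. by apply: measurable_cons. Qed.

Section cons_measure.
Context (R : realType) (n : nat).
Context (m : {sigma_finite_measure set (sample R n) -> \bar R}).

Definition cons_measure : set (sample R n.+1) -> \bar R :=
  pushforward (@lebesgue_measure R \x m)%E (@cons_pair R n).

Let preimage_measurable A : measurable A -> measurable (@cons_pair R n @^-1` A).
Proof.
by move=> mA; have := @measurable_cons_pair R n measurableT A mA; rewrite setTI.
Qed.

Let cons_measure0 : cons_measure set0 = 0%E.
Proof. by rewrite /cons_measure /pushforward preimage_set0 measure0. Qed.

Let cons_measure_ge0 A : (0 <= cons_measure A)%E.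
Proof. by rewrite /cons_measure /pushforward; apply: measure_ge0. Qed.

Let cons_measure_sigma_additive : semi_sigma_additive cons_measure.
Proof.
move=> F mF tF mUF; rewrite /cons_measure /pushforward preimage_bigcup.
apply: measure_semi_sigma_additive.
- by move=> k; exact: preimage_measurable.
- apply/trivIsetP => /= i j _ _ ij; rewrite -preimage_setI.
  by move/trivIsetP : tF => /(_ _ _ _ _ ij) ->//; rewrite preimage_set0.
- by rewrite -preimage_bigcup; exact: preimage_measurable.
Qed.

HB.instance Definition _ := isMeasure.Build _ _ _ cons_measure
  cons_measure0 cons_measure_ge0 cons_measure_sigma_additive.

Lemma cons_measure_sigma_finite : sigma_finite setT cons_measure.
Proof.
have [F [TF ndF Foo]] := (@sigma_finiteP _ _ _ _ _).1
  (sigma_finiteT (@lebesgue_measure R)).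
have [G [TG ndG Goo]] := (@sigma_finiteP _ _ _ _ _).1 (sigma_finiteT m).
pose split_tuple (t : sample R n.+1) : measurableTypeR R * sample R n :=
  (thead t, [tuple of behead t]).
have msplit : measurable_fun setT split_tuple.
  apply: measurable_fun_pair; first exact: measurable_tnth.
  exact: measurable_behead.
exists (fun k => split_tuple @^-1` (F k `*` G k)).
  apply/esym; rewrite -subTset => t _.
  have [i _ Fi] : (\bigcup_i F i) (thead t) by rewrite -TF.
  have [j _ Gj] : (\bigcup_i G i) [tuple of behead t] by rewrite -TG.
  exists (maxn i j) => //; split => /=.
  - by move: Fi; exact/subsetPset/ndF/leq_maxl.
  - by move: Gj; exact/subsetPset/ndG/leq_maxr.
move=> k; have [mF lF] := Foo k; have [mG lG] := Goo k; split.
  by have := msplit measurableT _ (measurableX mF mG); rewrite setTI.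
rewrite /cons_measure /pushforward.
rewrite (_ : _ @^-1` _ = F k `*` G k); last first.
  have splitK z : split_tuple (cons_pair z) = z.
    by case: z => x t; congr pair; apply/val_inj.
  by apply/funext => z; rewrite -[in RHS](splitK z).
by rewrite product_measure1E// lte_mul_pinfty// ge0_fin_numE.
Qed.

HB.instance Definition _ :=
  Measure_isSigmaFinite.Build _ _ _ cons_measure cons_measure_sigma_finite.

End cons_measure.

(* Lebesgue measure on R^n: the point mass on R^0, then the image of the product
   of [lebesgue_measure] with the Lebesgue measure of R^n under
   (x, t) |-> x :: t. *)
Fixpoint lebesgue_Rn (R : realType) (n : nat) :
    {sigma_finite_measure set (sample R n) -> \bar R} :=
  match n with
  | 0 => @dirac _ (sample R 0) [tuple] R
  | n.+1 => cons_measure (lebesgue_Rn R n)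
  end.

Lemma lebesgue_Rn_box (R : realType) (n : nat) (A : 'I_n -> set R) :
  (forall i, measurable (A i : set (measurableTypeR R))) ->
  lebesgue_Rn R n [set x | forall i, A i (tnth x i)] =
  (\prod_(i < n) lebesgue_measure (A i))%E.
Proof.
elim: n A => [|n IHn] A mA.
  by rewrite big_ord0 /= diracE mem_set//= => -[].
rewrite big_ord_recl /= -(IHn (fun i => A (lift ord0 i)))// /cons_measure /pushforward.
rewrite (_ : _ @^-1` _ =
    A ord0 `*` [set x : sample R n | forall i, A (lift ord0 i) (tnth x i)]).
  apply: product_measure1E => //.
  rewrite (_ : [set _ | _] =
      \big[setI/setT]_(i < n) ((@tnth n _ ^~ i) @^-1` A (lift ord0 i))).
    apply: bigsetI_measurable => i _.
    have := @measurable_tnth _ (measurableTypeR R) n i measurableT _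
      (mA (lift ord0 i)).
    by rewrite setTI.
  apply/seteqP; split=> t /=.
    move=> H; apply: (big_ind (fun B : set _ => B t)) => [//|? ?|i _].
    - by split.
    - exact: H.
  by move=> + i; rewrite (bigD1 i)//=; case.
have tnth_lift x (t : sample R n) i :
    tnth (cons_pair (x, t)) (lift ord0 i) = tnth t i.
  by rewrite !(tnth_nth x).
apply/seteqP; split=> -[x t] /=.
  move=> H; split; first exact: (H ord0).
  by move=> i; have := H (lift ord0 i); rewrite tnth_lift.
move=> [Hx Ht] i; have [j ->|->//] := unliftP ord0 i.
by rewrite tnth_lift.
Qed.

Section geometry.
Context (R : realType) (d : nat).
Notation param := 'rV[R]_d.
Implicit Types (U : set param) (f : param -> R).

Definition partial (i : 'I_d) f : param -> R :=
  fun t => 'D_(delta_mx 0 i) f t.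

Definition partials (s : seq 'I_d) f : param -> R := foldr partial f s.

(* C^infinity on the open set U: all iterated partial derivatives exist and are
   differentiable (hence continuous) at every point of U. *)
Definition smooth_on U f : Prop :=
  forall s t, U t -> differentiable (partials s f) t.

Definition vector_field := param -> param.

Definition smooth_vector_field U (X : vector_field) : Prop :=
  forall k, smooth_on U (fun t => X t 0 k).

Definition coord_field (i : 'I_d) : vector_field := fun=> delta_mx 0 i.

Definition vf_apply (X : vector_field) f : param -> R := fun t => 'D_(X t) f t.

Definition lie_bracket (X Y : vector_field) : vector_field := fun t =>
  \row_k (vf_apply X (fun u => Y u 0 k) t - vf_apply Y (fun u => X u 0 k) t).

(* Tensors, metrics and connections are given by their components with respect
   to the coordinates of R^d; only their values on the parameter set matter. *)
Definition metric := param -> 'M[R]_d.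

Definition inner (g : metric) (X Y : vector_field) : param -> R := fun t =>
  (X t *m g t *m (Y t)^T) 0 0.

Definition pos_def (A : 'M[R]_d) : Prop :=
  forall v : 'rV[R]_d, v != 0 -> 0 < (v *m A *m v^T) 0 0.

Definition riemannian_metric U (g : metric) : Prop :=
  (forall i j, smooth_on U (fun t => g t i j)) /\
  (forall t, U t -> (g t)^T = g t /\ pos_def (g t)).

Definition connection := vector_field -> vector_field -> vector_field.

(* The affine connection with
   nabla_{d_i} d_j = \sum_k Gamma i j k d_k. *)
Definition connection_of (Gamma : 'I_d -> 'I_d -> 'I_d -> param -> R) :
    connection := fun X Y t =>
  \row_k (vf_apply X (fun u => Y u 0 k) t +
          \sum_(i < d) \sum_(j < d) X t 0 i * Y t 0 j * Gamma i j k t).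

(* The affine connection with g(nabla_{d_i} d_j, d_k) = Gamma1 i j k. *)
Definition connection_of_first_kind (g : metric)
    (Gamma1 : 'I_d -> 'I_d -> 'I_d -> param -> R) : connection :=
  connection_of (fun i j k t =>
    \sum_(l < d) Gamma1 i j l t * invmx (g t) l k).

Definition compatible U (nabla : connection) (g : metric) : Prop :=
  forall X Y Z, smooth_vector_field U X -> smooth_vector_field U Y ->
    smooth_vector_field U Z -> forall t, U t ->
    vf_apply X (inner g Y Z) t =
    inner g (nabla X Y) Z t + inner g Y (nabla X Z) t.

Definition torsion_free U (nabla : connection) : Prop :=
  forall X Y, smooth_vector_field U X -> smooth_vector_field U Y ->
    forall t, U t -> nabla X Y t - nabla Y X t = lie_bracket X Y t.

Definition is_levi_civita U (nabla : connection) (g : metric) : Prop :=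
  [/\ riemannian_metric U g, torsion_free U nabla & compatible U nabla g].

Definition euclidean_metric : metric := fun=> 1%:M.

(* Koszul's formula in coordinates. *)
Definition levi_civita (g : metric) : connection :=
  connection_of_first_kind g (fun i j k t =>
    (partial i (fun u => g u j k) t + partial j (fun u => g u i k) t
     - partial k (fun u => g u i j) t) / 2).

Definition curvature (nabla : connection) (X Y Z : vector_field) :
    vector_field := fun t =>
  nabla X (nabla Y Z) t - nabla Y (nabla X Z) t - nabla (lie_bracket X Y) Z t.

(* The curvature tensor vanishes on U iff its components
   R(d_i, d_j) d_k do. *)
Definition flat U (g : metric) : Prop :=
  forall t, U t -> forall i j k,
    curvature (levi_civita g) (coord_field i) (coord_field j) (coord_field k) t
    = 0.

Definition hessian f : metric := fun t => \matrix_(i, j) partial i (partial j f) t.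

End geometry.

Section statistics.
Context (R : realType) (n d : nat).
Notation param := 'rV[R]_d.
Implicit Types (Theta : set param) (p : sample R n -> param -> R).

Definition is_density (f : sample R n -> R) : Prop :=
  [/\ measurable_fun setT f, forall x, 0 <= f x &
      (\int[lebesgue_Rn R n]_x (f x)%:E = 1)%E].

Definition expectation p (t : param) (f : sample R n -> R) : R :=
  \int[lebesgue_Rn R n]_x (f x * p x t).

Definition loglik p (x : sample R n) : param -> R := fun t => ln (p x t).

Definition fisher_rao p : metric R d := fun t =>
  \matrix_(i, j) expectation p t (fun x =>
    partial i (loglik p x) t * partial j (loglik p x) t).

Definition alpha_christoffel p (alpha : R) (i j k : 'I_d) (t : param) : R :=
  expectation p t (fun x =>
    (partial i (partial j (loglik p x)) t +
     (1 - alpha) / 2 * partial i (loglik p x) t * partial j (loglik p x) t) *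
    partial k (loglik p x) t).

Definition alpha_connection p (alpha : R) : connection R d :=
  connection_of_first_kind (fisher_rao p) (alpha_christoffel p alpha).

(* The usual regularity of statistical models; differentiation under the
   integral sign is required for the partial derivatives of p of every order. *)
Record regular_model Theta p : Prop := RegularModel {
  regular_density : forall t, Theta t -> is_density (p ^~ t);
  regular_smooth : forall x, smooth_on Theta (p x);
  regular_integrable : forall s t, Theta t ->
    (lebesgue_Rn R n).-integrable setT (fun x => (partials s (p x) t)%:E);
  regular_diff_int : forall s i t, Theta t ->
    partial i (fun u => \int[lebesgue_Rn R n]_x partials s (p x) u) t =
    \int[lebesgue_Rn R n]_x partials (i :: s) (p x) t;
  regular_pos_def : forall t, Theta t -> pos_def (fisher_rao p t)
}.

Definition exponential_family Theta p (h : sample R n -> R)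
    (phi : sample R n -> param) (F : param -> R) : Prop :=
  forall x t, Theta t ->
    p x t = expR (h x + \sum_(i < d) t 0 i * phi x 0 i - F t).

End statistics.

(* Main.v *)
Require Import Defs.
From HB Require Import structures.
From mathcomp Require Import all_boot all_order all_algebra.
From mathcomp Require Import all_classical all_reals all_analysis.
From mathcomp Require Import ring lra.

Set Implicit Arguments.
Unset Strict Implicit.
Unset Printing Implicit Defensive.

Import Order.TTheory GRing.Theory Num.Theory.
Import numFieldNormedType.Exports.

Local Open Scope classical_set_scope.
Local Open Scope ring_scope.

(** The score of an exponential family is [phi x - grad F], and the second
    derivatives [- d_i d_j F] of its log-likelihood are constant in [x].
    Differentiating the normalisation [\int p = 1] up to three times under the
    integral sign therefore computes the first three moments of the score: they
    are [0], [d_i d_j F] and [d_i d_j d_k F]. Hence the Fisher-Rao metric is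
    [G = Hess F] ([fisher_rao_hessian]) and the alpha-connection has
    [Gamma_{ij,k} = c * d_i G_jk] with [c = (1 - alpha) / 2]
    ([alpha_christoffelE]). From there on, the argument is pure Riemannian
    geometry: all it uses of [G] is that it is a Riemannian metric and that
    [d_i G_jk] is totally symmetric.

    Write [F_i] for the matrix [d_i G] and [A_i = c F_i G^-1] for the matrix of
    Christoffel symbols [Gamma_ij^k]. The connection is compatible with [g] if
    and only if [d_i g = A_i g + g A_i^T] ([compatible_connection_of]), and the
    total symmetry of [d_i G_jk] makes it torsion-free. For [c = 0], [1/2] and
    [1] the equation is solved by the Euclidean metric, by [G] and by [G^2],
    which gives the first three claims.

    For the last claim, the curvature is
    [R_ij = c (1 - c) K_ij G^-1] with [K_ij = F_i G^-1 F_j - F_j G^-1 F_i]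
    ([curvature_mxE]). The case [c = 1/2] is the Levi-Civita connection of [G],
    so a Fisher-Rao metric that is not flat has some [K_ij <> 0] at some point.
    If a metric [g] were compatible with the connection, [R_ij] would be skew
    for [g] ([compatible_curvature]), so [K_ij] would satisfy
    [K_ij (G^-1 g) = (G^-1 g)^T K_ij]. In dimension 2 a nonzero skew matrix only
    allows this when [G^-1 g] is scalar ([skew2_commutation]): near the point,
    [g = lambda G]. Then the compatibility equation reads
    [(2 c - 1) lambda F_i = (d_i lambda) G], so each [F_i] is a multiple of [G]
    and [K_ij] vanishes after all ([compatible_cubic_commutator0]). *)

(** * Smooth functions on an open set *)

(** The differential at a point is determined by the germ of the function: the
    first-order expansion of [f] is also one of [g]. *)
Lemma near_eq_differentiable (R : numFieldType) (V W : normedModType R)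
    (f g : V -> W) (x : V) :
  (\near x, f x = g x) -> differentiable f x -> differentiable g x.
Proof.
move=> fg df; have /diff_locallyP[cdf fE] := df.
have fgx : f x = g x by exact: (nbhs_singleton fg).
have gE : g \o shift x = cst (g x) + 'd f x +o_ 0 id.
  apply/eqaddoP => e e0.
  have /eqaddoP/(_ _ e0) := fE.
  have : \forall y \near 0, f (y + x) = g (y + x).
    by move: fg; rewrite (near_shift 0) subr0.
  by apply: filter_app2; near=> y => /= fgy; rewrite !fctE /= fgy fgx.
have dgE := diff_unique cdf gE.
by apply/diff_locallyP; rewrite dgE.
Unshelve. all: by end_near. Qed.

Section smooth_functions.
Context (R : realType) (d : nat).
Notation param := 'rV[R]_d.
Implicit Types (U : set param) (f g : param -> R).

Lemma eq_partial U f g (i : 'I_d) t : open U -> U t ->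
  (forall u, U u -> f u = g u) -> partial i f t = partial i g t.
Proof.
move=> oU Ut fg; apply: near_eq_derive.
by have := open_nbhs_nbhs (conj oU Ut); apply: filterS => u /fg.
Qed.

Lemma eq_differentiable U f g t : open U -> U t ->
  (forall u, U u -> f u = g u) -> differentiable f t -> differentiable g t.
Proof.
move=> oU Ut fg; apply: near_eq_differentiable.
by have := open_nbhs_nbhs (conj oU Ut); apply: filterS => u /fg.
Qed.

(** Smoothness speaks of all iterated partial derivatives at once. It can be
    proved by coinduction: a class of differentiable functions that is stable
    under partial derivatives, up to equality on [U], consists of smooth
    functions. *)
Lemma smooth_on_coind U (P : (param -> R) -> Prop) : open U ->
  (forall f, P f -> (forall t, U t -> differentiable f t) /\
    forall i, exists2 g, P g & forall t, U t -> partial i f t = g t) ->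
  forall f, P f -> smooth_on U f.
Proof.
move=> oU HP f Pf.
have Ps s : exists2 g, P g & forall t, U t -> partials s f t = g t.
  elim: s => [|i s [g Pg fg]]; first by exists f.
  have [_ /(_ i)[h Ph gh]] := HP g Pg.
  by exists h => // t Ut /=; rewrite (eq_partial i oU Ut fg) gh.
move=> s t Ut; have [g Pg fg] := Ps s.
apply: (eq_differentiable oU Ut (f := g)); first by move=> u /fg.
by have [+ _] := HP g Pg; exact.
Qed.

Lemma partial_cst (i : 'I_d) (c : R) (t : param) : partial i (fun=> c) t = 0.
Proof. exact: derive_cst. Qed.

Lemma partial_coord (i j : 'I_d) (t : param) :
  partial i (fun u => u 0 j) t = (i == j)%:R.
Proof.
rewrite /partial; pose c := fun u : param => u 0 j.
have dc : derivable (id : param -> param) t (delta_mx 0 i) by exact: derivable_id.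
have := derive_mx dc; rewrite derive_id => /matrixP/(_ 0 j).
by rewrite !mxE eqxx/= eq_sym => ->.
Qed.

Lemma partialD (i : 'I_d) f g t : differentiable f t -> differentiable g t ->
  partial i (fun u => f u + g u) t = partial i f t + partial i g t.
Proof. by move=> df dg; apply: deriveD; exact: diff_derivable. Qed.

Lemma partialN (i : 'I_d) f t : differentiable f t ->
  partial i (fun u => - f u) t = - partial i f t.
Proof. by move=> df; apply: deriveN; exact: diff_derivable. Qed.

Lemma partialM (i : 'I_d) f g t : differentiable f t -> differentiable g t ->
  partial i (fun u => f u * g u) t = partial i f t * g t + f t * partial i g t.
Proof.
move=> /diff_derivable df /diff_derivable dg.
transitivity (f t *: partial i g t + g t *: partial i f t); first exact: deriveM.
by rewrite addrC /GRing.scale/= [g t * _]mulrC.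
Qed.

Lemma partialV (i : 'I_d) f t : differentiable f t -> f t != 0 ->
  partial i (fun u => (f u)^-1) t = - (f t)^-1 ^+ 2 * partial i f t.
Proof.
move=> /diff_derivable df f0.
by rewrite /partial (deriveV f0 (df _)) exprVn.
Qed.

Lemma differentiable_ln (x : R) : 0 < x -> differentiable (@ln R) x.
Proof. by move=> x0; apply/derivable1_diffP; have [] := is_derive1_ln x0. Qed.

Lemma partial_ln (i : 'I_d) f t : differentiable f t -> 0 < f t ->
  partial i (fun u => ln (f u)) t = (f t)^-1 * partial i f t.
Proof.
move=> df f0; have dln := differentiable_ln f0.
rewrite /partial deriveE; last exact: differentiable_comp.
rewrite (diff_comp df dln) /= deriv1E ?derive1E; last by have [] := is_derive1_ln f0.
have [_ ->] := is_derive1_ln f0.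
by rewrite deriveE//= /GRing.scale/= mulrC.
Qed.

(** The class to which coinduction is applied. Closing it under all operations
    simultaneously makes the product, quotient and chain rules express each
    partial derivative within the class, with no bookkeeping of orders. *)
Inductive smooth_expr U : (param -> R) -> Prop :=
| expr_smooth f : smooth_on U f -> smooth_expr U f
| expr_cst c : smooth_expr U (fun=> c)
| expr_coord j : smooth_expr U (fun u => u 0 j)
| expr_add f g : smooth_expr U f -> smooth_expr U g ->
    smooth_expr U (fun u => f u + g u)
| expr_mul f g : smooth_expr U f -> smooth_expr U g ->
    smooth_expr U (fun u => f u * g u)
| expr_inv f : smooth_expr U f -> (forall t, U t -> f t != 0) ->
    smooth_expr U (fun u => (f u)^-1)
| expr_ln f : smooth_expr U f -> (forall t, U t -> 0 < f t) ->
    smooth_expr U (fun u => ln (f u)).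

Lemma smooth_partial U f (i : 'I_d) : smooth_on U f -> smooth_on U (partial i f).
Proof.
by move=> sf s t Ut; have := sf (rcons s i) t Ut; rewrite /partials foldr_rcons.
Qed.

Lemma smooth_differentiable U f t : smooth_on U f -> U t -> differentiable f t.
Proof. by move=> /(_ [::]); exact. Qed.

Lemma smooth_expr_smooth U f : open U -> smooth_expr U f -> smooth_on U f.
Proof.
move=> oU; move: f; apply: smooth_on_coind => // f.
elim=> {f} [f sf|c|j|f g ef [df pf] eg [dg pg]|f g ef [df pf] eg [dg pg]
           |f ef [df pf] f0|f ef [df pf] f0].
- split=> [t Ut|i]; first exact: smooth_differentiable sf Ut.
  by exists (partial i f) => //; apply/expr_smooth/smooth_partial.
- split=> [t _|i]; first exact: differentiable_cst.
  by exists (fun=> 0); [exact: expr_cst|move=> t _; exact: partial_cst].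
- split=> [t _|i]; first exact: differentiable_coord.
  by exists (fun=> (i == j)%:R); [exact: expr_cst|move=> t _; exact: partial_coord].
- split=> [t Ut|i]; first by apply: differentiableD; [exact: df|exact: dg].
  have [[f' ef' ff'] [g' eg' gg']] := (pf i, pg i).
  exists (fun u => f' u + g' u); first exact: expr_add.
  by move=> t Ut; rewrite partialD ?ff' ?gg'//; [exact: df|exact: dg].
- split=> [t Ut|i]; first by apply: differentiableM; [exact: df|exact: dg].
  have [[f' ef' ff'] [g' eg' gg']] := (pf i, pg i).
  exists (fun u => f' u * g u + f u * g' u).
    by apply: expr_add; apply: expr_mul.
  by move=> t Ut; rewrite partialM ?ff' ?gg'//; [exact: df|exact: dg].
- split=> [t Ut|i]; first by apply: differentiableV; [exact: df|exact: f0].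
  have [f' ef' ff'] := pf i.
  exists (fun u => -1 * ((f u)^-1 * (f u)^-1) * f' u).
    apply: expr_mul => //; apply: expr_mul; first exact: expr_cst.
    by apply: expr_mul; apply: expr_inv.
  move=> t Ut; rewrite partialV ?ff' ?mulN1r//; [exact: df|exact: f0].
- split=> [t Ut|i].
    by apply: differentiable_comp; [exact: df|apply/differentiable_ln/f0].
  have [f' ef' ff'] := pf i.
  exists (fun u => (f u)^-1 * f' u).
    apply: expr_mul => //; apply: expr_inv => // t /f0 ft0.
    by rewrite gt_eqF.
  by move=> t Ut; rewrite partial_ln ?ff'//; [exact: df|exact: f0].
Qed.

Section closure.
Variable U : set param.
Hypothesis oU : open U.

Lemma smooth_cst c : smooth_on U (fun=> c).
Proof. exact/smooth_expr_smooth/expr_cst. Qed.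

Lemma smooth_coord j : smooth_on U (fun u => u 0 j).
Proof. exact/smooth_expr_smooth/expr_coord. Qed.

Lemma smoothD f g : smooth_on U f -> smooth_on U g ->
  smooth_on U (fun u => f u + g u).
Proof.
by move=> sf sg; apply/smooth_expr_smooth/expr_add => //; exact: expr_smooth.
Qed.

Lemma smoothM f g : smooth_on U f -> smooth_on U g ->
  smooth_on U (fun u => f u * g u).
Proof.
by move=> sf sg; apply/smooth_expr_smooth/expr_mul => //; exact: expr_smooth.
Qed.

Lemma smoothV f : smooth_on U f -> (forall t, U t -> f t != 0) ->
  smooth_on U (fun u => (f u)^-1).
Proof.
by move=> sf f0; apply/smooth_expr_smooth/expr_inv => //; exact: expr_smooth.
Qed.

Lemma smooth_ln f : smooth_on U f -> (forall t, U t -> 0 < f t) ->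
  smooth_on U (fun u => ln (f u)).
Proof.
by move=> sf f0; apply/smooth_expr_smooth/expr_ln => //; exact: expr_smooth.
Qed.

Lemma smooth_sum (I : Type) (r : seq I) (f : I -> param -> R) :
  (forall i, smooth_on U (f i)) ->
  smooth_on U (fun u => \sum_(i <- r) f i u).
Proof.
move=> sf; elim: r => [|i r IHr].
  by under eq_fun do rewrite big_nil; exact: smooth_cst.
by under eq_fun do rewrite big_cons; exact: smoothD.
Qed.

Lemma smooth_prod (I : Type) (r : seq I) (f : I -> param -> R) :
  (forall i, smooth_on U (f i)) ->
  smooth_on U (fun u => \prod_(i <- r) f i u).
Proof.
move=> sf; elim: r => [|i r IHr].
  by under eq_fun do rewrite big_nil; exact: smooth_cst.
by under eq_fun do rewrite big_cons; exact: smoothM.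
Qed.

Lemma eq_smooth f g : (forall t, U t -> f t = g t) ->
  smooth_on U f -> smooth_on U g.
Proof.
move=> fg sf.
apply: (smooth_on_coind (P := fun h => exists2 k, smooth_on U k &
    forall t, U t -> k t = h t)) => //; last by exists f.
move=> h [k sk kh]; split=> [t Ut|i].
  exact: (eq_differentiable oU Ut kh (smooth_differentiable sk Ut)).
exists (partial i k); first by exists (partial i k) => //; exact: smooth_partial.
by move=> t Ut; rewrite (eq_partial i oU Ut kh).
Qed.

End closure.
End smooth_functions.

(** * Symmetry of second derivatives *)

Section mixed_derivatives.
Context (R : realType) (V : normedModType R).
Implicit Types (f : V -> R) (t v w : V).

Lemma is_derive_line f (a v : V) (x : R) : derivable f (x *: v + a) v ->
  is_derive x 1 (fun y => f (y *: v + a)) ('D_v f (x *: v + a)).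
Proof.
have E : (fun h : R => h^-1 *: ((fun y => f (y *: v + a)) (h *: 1 + x) -
    f (x *: v + a))) = (fun h => h^-1 *: (f (h *: v + (x *: v + a)) -
    f (x *: v + a))).
  by apply/funext => h; rewrite scalerDl addrA [h *: 1]mulr1.
by move=> df; split; rewrite /derivable /derive /= E.
Qed.

(** The second difference quotient of [f] along [v] and [w] tends to
    [D_w (D_v f)]. The mean value theorem along [v] turns the second difference
    into [h] times a difference of two values of [D_v f] close to [t], which the
    differentiability of [D_v f] at [t] evaluates up to [o(h)]. *)
Lemma second_difference (U : set V) f t v w (e : R) : open U -> U t ->
  (forall u, U u -> derivable f u v) -> differentiable ('D_v f) t -> 0 < e ->
  \forall h \near 0^'+,
    `|f (h *: v + (h *: w + t)) - f (h *: v + t) - f (h *: w + t) + f t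
      - h ^+ 2 * 'D_w ('D_v f) t| <= e * h ^+ 2.
Proof.
move=> oU Ut df dg e0; set g := 'D_v f.
(* [C * h] bounds the sum of the norms of the two displacements at which the
   first-order expansion of [D_v f] is used. *)
pose C := 2 * `|v| + `|w| + 1.
have C0 : 0 < C by rewrite ltr_pwDr// addr_ge0// mulr_ge0.
have /diff_locally/eqaddoP/(_ _ (divr_gt0 e0 C0)) rem := dg.
have inU : \forall k \near (0 : V), U (k + t).
  have := open_nbhs_nbhs (conj oU Ut).
  by move=> /(nbhs0P U t).1; apply: filterS => k; rewrite addrC.
have : \forall k \near (0 : V),
    `|g (k + t) - (g t + 'd g t k)| <= e / C * `|k| /\ U (k + t).
  by apply: filterI => //; exact: rem.
move=> /nbhs_norm0P[r /= r0 good].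
near=> h.
have h0 : 0 < h by [].
have small x y : 0 <= x <= h -> 0 <= y <= h -> `|x *: v + y *: w| < r.
  move=> /andP[x0 xh] /andP[y0 yh].
  apply: (@le_lt_trans _ _ (h * C)).
    rewrite (le_trans (ler_normD _ _))// !normrZ !ger0_norm// /C.
    have : x * `|v| <= h * `|v| by rewrite ler_wpM2r.
    have : y * `|w| <= h * `|w| by rewrite ler_wpM2r.
    have : 0 <= h * `|v| by rewrite mulr_ge0// ltW.
    by rewrite !mulrDr mulr1; lra.
  by rewrite -ltr_pdivlMr//; near: h; apply: nbhs_right_lt; rewrite divr_gt0.
have Uh x y : 0 <= x <= h -> 0 <= y <= h -> U (x *: v + (y *: w + t)).
  by move=> xh yh; have [_] := good _ (small x y xh yh); rewrite addrA.
have h_le : 0 <= h <= h by rewrite (ltW h0) /=.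
have z_le : 0 <= (0 : R) <= h by rewrite lexx /= ltW.
(* The second difference is the increment of [F] between [0] and [h]. *)
pose F x := f (x *: v + (h *: w + t)) - f (x *: v + t).
have Fd x : 0 <= x <= h ->
    is_derive x 1 F (g (x *: v + (h *: w + t)) - g (x *: v + t)).
  move=> xh; apply: is_deriveB; apply: is_derive_line; apply: df.
    exact: Uh.
  by have := Uh x 0 xh z_le; rewrite scale0r add0r.
have [x xh Fx] : exists2 x, x \in `]0, h[%R & F h - F 0 =
    (g (x *: v + (h *: w + t)) - g (x *: v + t)) * (h - 0).
  apply: (@MVT _ F (fun x => g (x *: v + (h *: w + t)) - g (x *: v + t))) => //.
    by move=> x; rewrite in_itv/= => /andP[x0 xh]; apply: Fd; rewrite !ltW.
  apply: derivable_within_continuous => x; rewrite in_itv/= => xh.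
  by have [] := Fd x xh.
move: xh; rewrite in_itv/= => /andP[x0 xh].
have xh' : 0 <= x <= h by rewrite !ltW.
have r1 := (good _ (small x h xh' h_le)).1.
have r2 := (good _ (small x 0 xh' z_le)).1.
have dE y z : 'd g t (y *: v + z *: w) = y * 'd g t v + z * 'd g t w.
  by rewrite linearD !linearZ.
move: r1 r2; rewrite !dE mul0r scale0r !addr0 -addrA.
move: Fx; rewrite /F scale0r !add0r subr0.
rewrite (deriveE _ dg) -/g; set a := g (_ + _); set b := g (_ + t).
move: ('d g t v) ('d g t w) => d1 d2 Fx r1 r2.
have -> : f (h *: v + (h *: w + t)) - f (h *: v + t) - f (h *: w + t) + f t =
    (a - b) * h.
  by rewrite -Fx; ring.
have -> : (a - b) * h - h ^+ 2 * d2 =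
    h * ((a - (g t + (x * d1 + h * d2))) - (b - (g t + x * d1))).
  by ring.
rewrite normrM (gtr0_norm h0) (_ : e * h ^+ 2 = h * (e / C * (h * C))); last first.
  by field; rewrite gt_eqF.
rewrite ler_pM2l//.
rewrite (le_trans (ler_normB _ _))//.
rewrite (le_trans (lerD r1 r2))// -mulrDr ler_pM2l ?divr_gt0//.
have n1 : `|x *: v + h *: w| <= h * `|v| + h * `|w|.
  rewrite (le_trans (ler_normD _ _))// !normrZ !gtr0_norm// lerD2r.
  by rewrite ler_wpM2r// ltW.
have n2 : `|x *: v| <= h * `|v|.
  by rewrite normrZ gtr0_norm// ler_wpM2r// ltW.
by rewrite (le_trans (lerD n1 n2))// /C !mulrDr; lra.
Unshelve. all: by end_near. Qed.

(** Young's form of Schwarz's theorem: the second difference is symmetric in [v]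
    and [w], so its quotient has both mixed derivatives as limit. *)
Lemma deriveC (U : set V) f t v w : open U -> U t ->
  (forall u, U u -> derivable f u v) -> (forall u, U u -> derivable f u w) ->
  differentiable ('D_v f) t -> differentiable ('D_w f) t ->
  'D_w ('D_v f) t = 'D_v ('D_w f) t.
Proof.
move=> oU Ut dv dw dgv dgw; apply/eqP; rewrite -subr_eq0 -normr_le0.
apply/ler_addgt0Pr => e e0; rewrite add0r.
have e20 : 0 < e / 2 by rewrite divr_gt0.
have Dvw := second_difference w oU Ut dv dgv e20.
have Dwv := second_difference v oU Ut dw dgw e20.
have [h [[h1 h2] h0]] :=
  filter_ex (filterI (filterI Dvw Dwv) (nbhs_right_gt (0 : R))).
have hh0 : 0 < h ^+ 2 by rewrite exprn_gt0.
rewrite -(ler_pM2l hh0) -[h ^+ 2 in leLHS]gtr0_norm// -normrM.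
move: h1 h2; set p := 'D_w _ t; set q := 'D_v _ t.
rewrite [h *: v + (h *: w + t)]addrCA => h1 h2.
have -> : h ^+ 2 * (p - q) =
  (f (h *: w + (h *: v + t)) - f (h *: w + t) - f (h *: v + t) + f t -
     h ^+ 2 * q) -
  (f (h *: w + (h *: v + t)) - f (h *: v + t) - f (h *: w + t) + f t -
     h ^+ 2 * p) by ring.
rewrite (le_trans (ler_normB _ _))// (le_trans (lerD h2 h1))//.
by rewrite -mulrDl -splitr mulrC.
Qed.

End mixed_derivatives.

Lemma partialC (R : realType) (d : nat) (U : set 'rV[R]_d) f t i j :
  open U -> smooth_on U f -> U t ->
  partial i (partial j f) t = partial j (partial i f) t.
Proof.
move=> oU sf Ut; apply: (deriveC oU Ut).
- by move=> u Uu; apply: diff_derivable; exact: smooth_differentiable sf Uu.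
- by move=> u Uu; apply: diff_derivable; exact: smooth_differentiable sf Uu.
- exact: smooth_differentiable (smooth_partial j sf) Ut.
- exact: smooth_differentiable (smooth_partial i sf) Ut.
Qed.

(** * Calculus of matrix-valued functions *)

Section matrix_calculus.
Context (R : realType) (d : nat).
Notation param := 'rV[R]_d.
Implicit Types (U : set param) (f : param -> R) (i : 'I_d).

Definition smooth_mx U m n (A : param -> 'M[R]_(m, n)) : Prop :=
  forall j k, smooth_on U (fun t => A t j k).

Definition mx_partial i m n (A : param -> 'M[R]_(m, n)) : param -> 'M[R]_(m, n) :=
  fun t => \matrix_(j, k) partial i (fun u => A u j k) t.

Lemma near_eq_mx_partial i m n (A B : param -> 'M[R]_(m, n)) t :
  (\near t, A t = B t) -> mx_partial i A t = mx_partial i B t.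
Proof.
move=> AB; apply/matrixP => j k; rewrite !mxE; apply: near_eq_derive.
by move: AB; apply: filterS => u ->.
Qed.

Lemma eq_mx_partial U i m n (A B : param -> 'M[R]_(m, n)) t : open U -> U t ->
  (forall u, U u -> A u = B u) -> mx_partial i A t = mx_partial i B t.
Proof.
move=> oU Ut AB; apply: near_eq_mx_partial.
by have := open_nbhs_nbhs (conj oU Ut); apply: filterS => u /AB.
Qed.

Lemma mx_partialT i m n (A : param -> 'M[R]_(m, n)) t :
  mx_partial i (fun u => (A u)^T) t = (mx_partial i A t)^T.
Proof.
apply/matrixP => j k; rewrite !mxE; congr (partial i _ t).
by apply/funext => u; rewrite mxE.
Qed.

Section smooth.
Variable U : set param.
Hypothesis oU : open U.

Lemma eq_smooth_mx m n (A B : param -> 'M[R]_(m, n)) :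
  (forall t, U t -> A t = B t) -> smooth_mx U A -> smooth_mx U B.
Proof.
by move=> AB sA j k; apply: (eq_smooth oU _ (sA j k)) => t /AB ->.
Qed.

Lemma smooth_mx_cst m n (A : 'M[R]_(m, n)) : smooth_mx U (fun=> A).
Proof. by move=> j k; exact: smooth_cst. Qed.

Lemma smooth_mx_trmx m n (A : param -> 'M[R]_(m, n)) :
  smooth_mx U A -> smooth_mx U (fun t => (A t)^T).
Proof. by move=> sA j k; under eq_fun do rewrite mxE; exact: sA. Qed.

Lemma smooth_mx_partial i m n (A : param -> 'M[R]_(m, n)) :
  smooth_mx U A -> smooth_mx U (mx_partial i A).
Proof.
by move=> sA j k; under eq_fun do rewrite mxE; apply: smooth_partial; exact: sA.
Qed.

Lemma smooth_mxZ m n f (A : param -> 'M[R]_(m, n)) :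
  smooth_on U f -> smooth_mx U A -> smooth_mx U (fun t => f t *: A t).
Proof.
move=> sf sA j k; under eq_fun do rewrite mxE.
by apply: smoothM.
Qed.

Lemma smooth_mxM m n q (A : param -> 'M[R]_(m, n)) (B : param -> 'M[R]_(n, q)) :
  smooth_mx U A -> smooth_mx U B -> smooth_mx U (fun t => A t *m B t).
Proof.
move=> sA sB j k; under eq_fun do rewrite mxE.
by apply: smooth_sum => // l; apply: smoothM.
Qed.

Lemma smooth_mxtrace n (A : param -> 'M[R]_n) :
  smooth_mx U A -> smooth_on U (fun t => \tr (A t)).
Proof. by move=> sA; apply: smooth_sum => // j; exact: sA. Qed.

Lemma smooth_det n (A : param -> 'M[R]_n) :
  smooth_mx U A -> smooth_on U (fun t => \det (A t)).
Proof.
move=> sA; apply: smooth_sum => // s; apply: smoothM => //.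
  exact: smooth_cst.
by apply: smooth_prod => // j; exact: sA.
Qed.

Lemma smooth_invmx n (A : param -> 'M[R]_n) :
  smooth_mx U A -> (forall t, U t -> A t \in unitmx) ->
  smooth_mx U (fun t => invmx (A t)).
Proof.
move=> sA uA; apply: (eq_smooth_mx (A := fun t => (\det (A t))^-1 *: \adj (A t))).
  by move=> t Ut; rewrite /invmx uA.
apply: smooth_mxZ.
  apply: smoothV => //; first exact: smooth_det.
  by move=> t Ut; have := uA t Ut; rewrite unitmxE unitfE.
move=> j k; under eq_fun do rewrite mxE.
apply: smoothM => //; first exact: smooth_cst.
apply: smooth_det => a b; under eq_fun do rewrite !mxE; exact: sA.
Qed.

Lemma mx_partialM i m n q (A : param -> 'M[R]_(m, n)) (B : param -> 'M[R]_(n, q)) t :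
  smooth_mx U A -> smooth_mx U B -> U t ->
  mx_partial i (fun u => A u *m B u) t =
  mx_partial i A t *m B t + A t *m mx_partial i B t.
Proof.
move=> sA sB Ut; apply/matrixP => j k; rewrite !mxE -big_split /=.
have dA a b := smooth_differentiable (sA a b) Ut.
have dB a b := smooth_differentiable (sB a b) Ut.
have -> : (fun u => (A u *m B u) j k) =
    \sum_(l < n) (fun u => A u j l * B u l k).
  by apply/funext => u; rewrite mxE fct_sumE.
rewrite /partial derive_sum; last first.
  by move=> l; apply: diff_derivable; exact: differentiableM.
by apply: eq_bigr => l _; rewrite !mxE -partialM.
Qed.

Lemma mx_partialZ i m n f (A : param -> 'M[R]_(m, n)) t :
  smooth_on U f -> smooth_mx U A -> U t ->
  mx_partial i (fun u => f u *: A u) t =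
  partial i f t *: A t + f t *: mx_partial i A t.
Proof.
move=> sf sA Ut; apply/matrixP => j k; rewrite !mxE.
under eq_fun do rewrite mxE.
by apply: partialM; exact: smooth_differentiable _ Ut.
Qed.

Lemma mx_partialC i j m n (A : param -> 'M[R]_(m, n)) t :
  smooth_mx U A -> U t ->
  mx_partial i (mx_partial j A) t = mx_partial j (mx_partial i A) t.
Proof.
move=> sA Ut; apply/matrixP => a b; rewrite [LHS]mxE [RHS]mxE.
have E l : (fun u => mx_partial l A u a b) = partial l (fun u => A u a b).
  by apply/funext => u; rewrite mxE.
by rewrite (E j) (E i); exact: partialC (sA a b) Ut.
Qed.

Lemma derive_partials f t v : smooth_on U f -> U t ->
  'D_v f t = \sum_i v 0 i * partial i f t.
Proof.
move=> sf Ut; have df := smooth_differentiable sf Ut.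
rewrite deriveE// {1}(row_sum_delta v) linear_sum /=; apply: eq_bigr => i _.
by rewrite linearZ /= /partial deriveE.
Qed.

End smooth.
End matrix_calculus.

(** * Connections and curvature in coordinates *)

Section connections.
Context (R : realType) (d : nat).
Notation param := 'rV[R]_d.
Implicit Types (U : set param) (g : metric R d) (i j k : 'I_d).
Implicit Types (X Y Z : vector_field R d).
Local Notation coord_field := (@coord_field R d).
Implicit Types (Gamma : 'I_d -> 'I_d -> 'I_d -> param -> R).

(** Row [j] is [nabla_{d_i} d_j], so that, on row vectors,
    [nabla_{d_i} Z = d_i Z + Z A_i] for this matrix [A_i]. *)
Definition christoffel_mx Gamma i : metric R d :=
  fun t => \matrix_(j, k) Gamma i j k t.

Lemma first_kind_christoffel_mx g (Gamma1 : 'I_d -> 'I_d -> 'I_d -> param -> R) i t :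
  christoffel_mx (fun i j k t => \sum_(l < d) Gamma1 i j l t * invmx (g t) l k) i t =
  christoffel_mx Gamma1 i t *m invmx (g t).
Proof.
by apply/matrixP => j k; rewrite !mxE; apply: eq_bigr => l _; rewrite mxE.
Qed.

Lemma smooth_vector_field_mx U X : smooth_vector_field U X <-> smooth_mx U X.
Proof. by split=> [sX j k|sX k]; [rewrite ord1; exact: sX|exact: sX]. Qed.

Lemma smooth_coord_field U i : open U -> smooth_vector_field U (coord_field i).
Proof. by move=> oU k; exact: smooth_cst. Qed.

Lemma connection_coordl Gamma i Z t :
  connection_of Gamma (coord_field i) Z t =
  mx_partial i Z t + Z t *m christoffel_mx Gamma i t.
Proof.
apply/matrixP => a k; rewrite ord1 !mxE; congr (_ + _).
rewrite (bigD1 i)//= [X in _ + X]big1 ?addr0.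
  by apply: eq_bigr => j _; rewrite !mxE !eqxx mul1r.
move=> l li; apply: big1 => j _.
by rewrite !mxE eqxx (negbTE li) !mul0r.
Qed.

Lemma mx_partial_cst i m n (A : 'M[R]_(m, n)) (t : param) :
  mx_partial i (fun=> A) t = 0.
Proof. by apply/matrixP => j k; rewrite !mxE; exact: partial_cst. Qed.

Lemma connection_coord Gamma i j t :
  connection_of Gamma (coord_field i) (coord_field j) t =
  row j (christoffel_mx Gamma i t).
Proof. by rewrite connection_coordl mx_partial_cst add0r -rowE. Qed.

Lemma connection_ofE U Gamma X Y t : smooth_vector_field U Y -> U t ->
  connection_of Gamma X Y t = \sum_i X t 0 i *:
    (mx_partial i Y t + Y t *m christoffel_mx Gamma i t).
Proof.
move=> sY Ut; apply/matrixP => a k; rewrite ord1 mxE summxE.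
rewrite /vf_apply (derive_partials _ (sY k) Ut) -big_split; apply: eq_bigr => i _.
rewrite !mxE mulrDr; congr (_ + _).
by rewrite mulr_sumr; apply: eq_bigr => j _; rewrite !mxE mulrA.
Qed.

Lemma inner_coord g i j t :
  inner g (coord_field i) (coord_field j) t = g t i j.
Proof.
rewrite /inner /coord_field trmx_delta -rowE.
by rewrite -colE !mxE.
Qed.

(** Both sides of the compatibility condition are linear over functions in [X],
    and the derivatives of [Y] and [Z] cancel by the product rule, so that the
    condition only has to be tested on coordinate fields. *)
Lemma compatible_connection_of U Gamma g : open U -> smooth_mx U g ->
  compatible U (connection_of Gamma) g <->
  forall i t, U t -> mx_partial i g t =
    christoffel_mx Gamma i t *m g t + g t *m (christoffel_mx Gamma i t)^T.
Proof.
move=> oU sg; split=> [comp i t Ut|comp X Y Z sX sY sZ t Ut].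
  apply/matrixP => j k; rewrite [LHS]mxE.
  have := comp (coord_field i) (coord_field j) (coord_field k)
    (smooth_coord_field i oU) (smooth_coord_field j oU) (smooth_coord_field k oU) t Ut.
  rewrite /vf_apply (_ : inner _ _ _ = fun u => g u j k); last first.
    by apply/funext => u; exact: inner_coord.
  move=> H; apply: (etrans H).
  rewrite /inner !connection_coord [RHS]mxE; congr (_ + _).
    by rewrite trmx_delta -colE -row_mul !mxE.
  by rewrite -rowE !mxE; apply: eq_bigr => l _; rewrite !mxE.
have [[mX mY] mZ] := (proj1 (smooth_vector_field_mx U X) sX,
  proj1 (smooth_vector_field_mx U Y) sY, proj1 (smooth_vector_field_mx U Z) sZ).
have mYg := smooth_mxM oU mY sg.
have mZT := smooth_mx_trmx mZ.
have sI : smooth_on U (inner g Y Z) by exact: (smooth_mxM oU mYg mZT).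
rewrite /vf_apply (derive_partials _ sI Ut).
rewrite /inner !(connection_ofE _ _ _ Ut)//.
rewrite linear_sum /= !mulmx_suml mulmx_sumr !summxE -big_split; apply: eq_bigr => i _.
rewrite linearZ /= -!scalemxAl -scalemxAr [in RHS]mxE [X in _ + X]mxE -mulrDr.
congr (_ * _).
have -> : partial i (fun u => (Y u *m g u *m (Z u)^T) 0 0) t =
    mx_partial i (fun u => Y u *m g u *m (Z u)^T) t 0 0 by rewrite mxE.
rewrite (mx_partialM i mYg mZT Ut) (mx_partialM i mY sg Ut) mx_partialT.
have addE (P Q : 'M[R]_1) : P 0 0 + Q 0 0 = (P + Q) 0 0 by rewrite mxE.
rewrite comp// addE; congr (fun_of_matrix _ 0 0).
rewrite !(mulmxDl, mulmxDr, linearD) /= trmx_mul !mulmxA.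
by rewrite !addrA; exact: addrAC.
Qed.

Lemma torsion_free_connection_of U Gamma :
  (forall i j k t, U t -> Gamma i j k t = Gamma j i k t) ->
  torsion_free U (connection_of Gamma).
Proof.
move=> sG X Y sX sY t Ut; apply/matrixP => a k; rewrite !mxE.
rewrite opprD addrACA [X in _ + X](_ : _ = 0) ?addr0//; apply/eqP.
rewrite subr_eq0 exchange_big /=; apply/eqP; apply: eq_bigr => i _.
by apply: eq_bigr => j _; rewrite sG// [Y t 0 i * _]mulrC.
Qed.

(** Row [k] is [R(d_i, d_j) d_k]; the order of the factors in the commutator
    comes from matrices acting on row vectors from the right. *)
Definition curvature_mx Gamma i j : metric R d := fun t =>
  let A := christoffel_mx Gamma in
  mx_partial i (A j) t - mx_partial j (A i) t + A j t *m A i t - A i t *m A j t.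

Lemma curvature_coord Gamma i j k t :
  curvature (connection_of Gamma) (coord_field i) (coord_field j)
    (coord_field k) t = row k (curvature_mx Gamma i j t).
Proof.
have dd a b c : connection_of Gamma (coord_field a)
    (connection_of Gamma (coord_field b) (coord_field c)) t =
    row c (mx_partial a (christoffel_mx Gamma b) t +
      christoffel_mx Gamma b t *m christoffel_mx Gamma a t).
  rewrite connection_coordl connection_coord linearD /= row_mul; congr (_ + _).
  apply/matrixP => x y; rewrite !mxE; congr (partial a _ t).
  by apply/funext => u; rewrite connection_coord !mxE.
rewrite /curvature !dd.
have lb0 : lie_bracket (coord_field i) (coord_field j) t = 0.
  apply/matrixP => x y; rewrite [LHS]mxE [RHS]mxE /vf_apply.
  rewrite (derive_cst ((delta_mx 0 j : param) 0 y)).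
  by rewrite (derive_cst ((delta_mx 0 i : param) 0 y)) subr0.
rewrite [X in _ - X](_ : _ = 0) ?subr0.
  rewrite -linearB /=; congr (row k _); rewrite /curvature_mx.
  by rewrite opprD addrACA addrA.
apply/matrixP => x y; rewrite [LHS]mxE [RHS]mxE /vf_apply lb0 derive0 add0r.
by rewrite big1// => l _; rewrite big1// => m _; rewrite mxE !mul0r.
Qed.

(** The curvature of a metric connection is skew for the metric: this is the
    integrability condition [d_i d_j g = d_j d_i g] of the system
    [d_i g = A_i g + g A_i^T]. *)
Lemma compatible_curvature U Gamma g i j t : open U -> smooth_mx U g ->
  (forall i, smooth_mx U (christoffel_mx Gamma i)) ->
  compatible U (connection_of Gamma) g -> U t ->
  curvature_mx Gamma i j t *m g t + g t *m (curvature_mx Gamma i j t)^T = 0.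
Proof.
move=> oU sg sG /(compatible_connection_of _ oU sg) comp Ut.
set A := christoffel_mx Gamma in sG comp *.
have sT a := smooth_mx_trmx (sG a).
have dd a b : mx_partial a (mx_partial b g) t =
  mx_partial a (A b) t *m g t + A b t *m (A a t *m g t + g t *m (A a t)^T) +
  ((A a t *m g t + g t *m (A a t)^T) *m (A b t)^T +
    g t *m (mx_partial a (A b) t)^T).
  rewrite (eq_mx_partial a oU Ut (comp b)).
  have -> : mx_partial a (fun u => A b u *m g u + g u *m (A b u)^T) t =
    mx_partial a (fun u => A b u *m g u) t +
    mx_partial a (fun u => g u *m (A b u)^T) t.
    apply/matrixP => x y; rewrite !mxE; under eq_fun do rewrite mxE.
    have s1 := smooth_mxM oU (sG b) sg; have s2 := smooth_mxM oU sg (sT b).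
    by apply: partialD; [exact: (smooth_differentiable (s1 x y))|
      exact: (smooth_differentiable (s2 x y))].
  by rewrite (mx_partialM a (sG b) sg Ut) (mx_partialM a sg (sT b) Ut)
    mx_partialT -!comp.
have := mx_partialC oU i j sg Ut; rewrite !dd => /eqP; rewrite -subr_eq0 => /eqP <-.
rewrite /curvature_mx -/A.
move: (mx_partial i (A j) t) (mx_partial j (A i) t) (A i t) (A j t) (g t).
move=> P Q a b M.
have -> : (P - Q + b *m a - a *m b)^T = P^T - Q^T + a^T *m b^T - b^T *m a^T.
  by rewrite raddfB raddfD raddfB /= !trmx_mul.
move: P^T Q^T a^T b^T => PT QT aT bT.
rewrite !(mulmxBl, mulmxDl, mulmxBr, mulmxDr) !mulmxA.
apply/matrixP => x y; rewrite !(mxE _ _ x y).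
by ring.
Qed.

End connections.

(** * Connections proportional to the derivative of a metric *)

Lemma pos_def_unitmx (R : realType) (n : nat) (g : 'M[R]_n) :
  pos_def g -> g \in unitmx.
Proof.
move=> pg; rewrite unitmxE unitfE; apply/det0P => -[v v0 vg].
by have := pg v v0; rewrite vg mul0mx mxE ltxx.
Qed.

(** Here the dimension 2 enters. For skew [K] of size 2 one has
    [K M + M^T K = (\tr M) K], so the hypothesis gives [2 K M = (\tr M) K], and a
    nonzero [K] is invertible. *)
Lemma skew2_commutation (R : realType) (K M : 'M[R]_2) :
  K^T = - K -> K != 0 -> K *m M = M^T *m K -> M = (\tr M / 2) *: 1%:M.
Proof.
move=> /matrixP sK K0 /matrixP KM.
have two (F : 'I_2 -> R) : \sum_(l < 2) F l = F 0 + F 1.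
  by rewrite big_ord_recl big_ord1; congr (_ + F _); apply/val_inj.
have I2 (l : 'I_2) : l = 0 \/ l = 1.
  by case: l => [[|[|//]] p]; [left|right]; apply/val_inj.
have K00 : K 0 0 = 0 by have := sK 0 0; rewrite !mxE => ?; lra.
have K11 : K 1 1 = 0 by have := sK 1 1; rewrite !mxE => ?; lra.
have K10 : K 1 0 = - K 0 1 by have := sK 0 1; rewrite !mxE.
have k0 : K 0 1 != 0.
  apply: contra_neq K0 => k0; apply/matrixP => a b; rewrite mxE.
  by case: (I2 a) => ->; case: (I2 b) => ->; rewrite ?K00 ?K11 ?K10 ?k0 ?oppr0.
have := KM 0 0; have := KM 1 1; have := KM 0 1; rewrite !mxE !two !mxE K00 K11 K10.
rewrite !mul0r !mulr0 !add0r !addr0 => e01 e11 e00.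
have m1 : M 1 1 = M 0 0.
  by apply: (mulfI k0); rewrite e01 mulrC.
have m2 : M 1 0 = 0.
  have : K 0 1 * M 1 0 = 0 by move: e00; rewrite mulrN mulrC => ?; lra.
  by move/eqP; rewrite mulf_eq0 (negbTE k0) => /eqP.
have m3 : M 0 1 = 0.
  have : K 0 1 * M 0 1 = 0 by move: e11; rewrite mulNr mulrC => ?; lra.
  by move/eqP; rewrite mulf_eq0 (negbTE k0) => /eqP.
apply/matrixP => a b.
by case: (I2 a) => ->; case: (I2 b) => ->; rewrite !mxE /mxtrace two ?m1 ?m2 ?m3 /=; lra.
Qed.

Section codazzi_connection.
Context (R : realType) (d : nat) (U : set 'rV[R]_d) (G : metric R d).
Context (Gamma : 'I_d -> 'I_d -> 'I_d -> 'rV[R]_d -> R) (c : R).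
Hypothesis oU : open U.
Hypothesis sG : smooth_mx U G.
Hypothesis symG : forall t, U t -> (G t)^T = G t.
Hypothesis uG : forall t, U t -> G t \in unitmx.
Hypothesis GammaE : forall i t, U t ->
  christoffel_mx Gamma i t = c *: mx_partial i G t *m invmx (G t).

Lemma smooth_christoffel_mx i : smooth_mx U (christoffel_mx Gamma i).
Proof.
apply: (eq_smooth_mx oU (A := fun t => c *: mx_partial i G t *m invmx (G t))).
  by move=> t Ut; rewrite GammaE.
apply: smooth_mxM => //; last exact: smooth_invmx.
by apply: smooth_mxZ; [exact: oU|exact: smooth_cst|exact: smooth_mx_partial].
Qed.

(** The part of the curvature that does not depend on [c]; up to the factor
    [c (1 - c)] it is the curvature with one index lowered by [G]. *)
Definition cubic_commutator (i j : 'I_d) : metric R d := fun t =>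
  mx_partial i G t *m invmx (G t) *m mx_partial j G t -
  mx_partial j G t *m invmx (G t) *m mx_partial i G t.

Lemma mx_partial_sym i t : U t -> (mx_partial i G t)^T = mx_partial i G t.
Proof. by move=> Ut; rewrite -mx_partialT; exact: eq_mx_partial symG. Qed.

Lemma cubic_commutator_skew i j t : U t ->
  (cubic_commutator i j t)^T = - cubic_commutator i j t.
Proof.
move=> Ut; have [Pi Pj] := (mx_partial_sym i Ut, mx_partial_sym j Ut).
have HT : (invmx (G t))^T = invmx (G t) by rewrite trmx_inv (symG Ut).
rewrite /cubic_commutator; move: (mx_partial i G t) (mx_partial j G t) Pi Pj HT.
move: (invmx (G t)) => H P Q PT QT HT.
by rewrite linearB /= !trmx_mul PT QT HT opprB !mulmxA.
Qed.

Lemma smooth_cubic_commutator i j : smooth_mx U (cubic_commutator i j).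
Proof.
have sFHF a b : smooth_mx U
    (fun t => mx_partial a G t *m invmx (G t) *m mx_partial b G t).
  by apply: smooth_mxM => //; [apply: smooth_mxM => //; [|exact: smooth_invmx]|];
    exact: smooth_mx_partial.
move=> a b; rewrite (_ : (fun _ => _) = fun t =>
  (mx_partial i G t *m invmx (G t) *m mx_partial j G t) a b + -1 *
  (mx_partial j G t *m invmx (G t) *m mx_partial i G t) a b).
  apply: smoothD => //; first exact: sFHF.
  by apply: smoothM => //; [exact: smooth_cst|exact: sFHF].
by apply/funext => t; rewrite /cubic_commutator [LHS]mxE [X in _ + X]mxE mulN1r.
Qed.

(** Differentiating [A_j G = c F_j] expresses [d_i A_j] without derivatives of
    the inverse of [G]; the second derivatives of [G] cancel in the commutator
    by Schwarz's theorem. The factor is [c - c^2], the first term coming from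
    [d_i A_j - d_j A_i] and the second from the product of the [A_i]. *)
Lemma curvature_mxE i j t : U t -> curvature_mx Gamma i j t =
  (c * (1 - c)) *: (cubic_commutator i j t *m invmx (G t)).
Proof.
move=> Ut; have sF a : smooth_mx U (mx_partial a G) by exact: smooth_mx_partial.
have GV := mulmxV (uG Ut).
have dA a b : mx_partial a (christoffel_mx Gamma b) t =
    (c *: mx_partial a (mx_partial b G) t -
     christoffel_mx Gamma b t *m mx_partial a G t) *m invmx (G t).
  have AG u : U u -> christoffel_mx Gamma b u *m G u = c *: mx_partial b G u.
    by move=> Uu; rewrite GammaE// mulmxKV// uG.
  have := eq_mx_partial a oU Ut AG.
  rewrite (mx_partialM a (smooth_christoffel_mx b) sG Ut).
  rewrite (mx_partialZ a (smooth_cst oU c) (sF b) Ut) partial_cst scale0r add0r.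
  by move=> <-; rewrite addrK -mulmxA GV mulmx1.
rewrite /curvature_mx !dA (mx_partialC oU j i sG Ut) !GammaE// /cubic_commutator.
move: (mx_partial i (mx_partial j G) t) (mx_partial i G t) (mx_partial j G t).
move: (invmx (G t)) => H S P Q.
rewrite -!scalemxAl -!scalemxAr !mulmxBl -!scalemxAl !mulmxA.
apply/matrixP => x y; rewrite !(mxE _ _ x y); ring.
Qed.

End codazzi_connection.

Section rigidity.
Context (R : realType) (U : set 'rV[R]_2) (G g : metric R 2).
Context (Gamma : 'I_2 -> 'I_2 -> 'I_2 -> 'rV[R]_2 -> R) (c : R).
Hypothesis oU : open U.
Hypothesis sG : smooth_mx U G.
Hypothesis symG : forall t, U t -> (G t)^T = G t.
Hypothesis uG : forall t, U t -> G t \in unitmx.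
Hypothesis GammaE : forall i t, U t ->
  christoffel_mx Gamma i t = c *: mx_partial i G t *m invmx (G t).
Hypothesis c0 : c != 0.
Hypothesis c1 : c != 1.
Hypothesis c2 : 2 * c != 1.
Hypothesis rg : riemannian_metric U g.
Hypothesis comp : compatible U (connection_of Gamma) g.

(** The curvature is [c (1 - c) K G^-1] with [K] skew, so its skewness for [g]
    becomes a commutation relation once [c (1 - c)] is cancelled. *)
Lemma compatible_commutation i j t : U t ->
  cubic_commutator G i j t *m (invmx (G t) *m g t) =
  (invmx (G t) *m g t)^T *m cubic_commutator G i j t.
Proof.
move=> Ut; have [sg /(_ t Ut)[gT _]] := rg.
have := compatible_curvature i j oU sg
  (smooth_christoffel_mx oU sG uG GammaE) comp Ut.
rewrite (curvature_mxE oU sG uG GammaE i j Ut).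
have KT := cubic_commutator_skew oU symG i j Ut.
have HT : (invmx (G t))^T = invmx (G t) by rewrite trmx_inv (symG Ut).
move: (cubic_commutator G i j t) (invmx (G t)) (g t) KT HT gT => K H h KT HT hT.
rewrite linearZ /= trmx_mul KT HT -scalemxAl -scalemxAr -scalerDr => /eqP.
rewrite scaler_eq0 mulf_eq0 (negbTE c0) subr_eq0 [1 == c]eq_sym (negbTE c1) /=.
by rewrite !mulmxN subr_eq0 trmx_mul HT hT !mulmxA => /eqP.
Qed.

Lemma compatible_conformal i j t : U t -> cubic_commutator G i j t != 0 ->
  g t = (\tr (invmx (G t) *m g t) / 2) *: G t.
Proof.
move=> Ut K0.
have := skew2_commutation (cubic_commutator_skew oU symG i j Ut) K0
  (compatible_commutation i j Ut).
set l := _ / 2 => /(congr1 (mulmx (G t))).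
by rewrite mulmxA mulmxV ?uG// mul1mx -scalemxAr mulmx1.
Qed.

Lemma near_cubic_commutator_neq0 i j t : U t -> cubic_commutator G i j t != 0 ->
  \forall u \near t, U u /\ cubic_commutator G i j u != 0.
Proof.
move=> Ut K0; apply: filterI; first exact: (open_nbhs_nbhs (conj oU Ut)).
have [[a b] Kab] : exists ab, cubic_commutator G i j t ab.1 ab.2 != 0.
  apply: contrapT => nex; move/eqP: K0; apply; apply/matrixP => a b.
  rewrite [RHS]mxE; apply/eqP; apply: contrapT => /negP Kab.
  by apply: nex; exists (a, b).
have sK := smooth_cubic_commutator oU sG uG i j.
have cK := differentiable_continuous (smooth_differentiable (sK a b) Ut).
have : \forall u \near t, cubic_commutator G i j u a b != 0.
  exact: cvgr_neq0 cK Kab.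
apply: filterS => u Ku.
by apply: contra_neq Ku => ->; rewrite mxE.
Qed.

(** If [K_ij] did not vanish at [t], then [g = lambda G] on a neighbourhood of
    [t] could be differentiated and compared with the compatibility equation,
    which gives [(2 c - 1) lambda d_a G = (d_a lambda) G]. Metrics whose
    derivatives are all multiples of themselves have [K_ij = 0]. *)
Lemma compatible_cubic_commutator0 i j t : U t -> cubic_commutator G i j t = 0.
Proof.
move=> Ut; apply/eqP; apply: contrapT => /negP K0.
have [sg /(_ t Ut)[_ pg]] := rg.
pose lam u := \tr (invmx (G u) *m g u) / 2.
have nearg : \forall u \near t, g u = lam u *: G u.
  have := near_cubic_commutator_neq0 Ut K0; apply: filterS => u [Uu Ku].
  exact: compatible_conformal Uu Ku.
have gt : g t = lam t *: G t := nbhs_singleton nearg.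
have l0 : lam t != 0.
  apply/eqP => l0; have := pos_def_unitmx pg.
  by rewrite gt l0 scale0r unitmxE det0 unitr0.
have slam : smooth_on U lam.
  have sH := smooth_invmx oU sG uG.
  apply: smoothM => //; last exact: smooth_cst.
  by apply: smooth_mxtrace => //; exact: smooth_mxM.
have FE a : exists x, mx_partial a G t = x *: G t.
  have := near_eq_mx_partial a nearg.
  rewrite (mx_partialZ a slam sG Ut).
  rewrite ((compatible_connection_of _ oU sg).1 comp a t Ut) (GammaE a Ut) gt.
  have HT : (invmx (G t))^T = invmx (G t) by rewrite trmx_inv (symG Ut).
  rewrite trmx_mul HT [(c *: _)^T]linearZ /= (mx_partial_sym oU symG a Ut).
  rewrite -!scalemxAl -!scalemxAr mulmxKV ?uG// !mulmxA mulmxV ?uG// mul1mx.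
  move: (partial a lam t) (mx_partial a G t) => p F E.
  exists (p / ((2 * c - 1) * lam t)).
  have n0 : (2 * c - 1) * lam t != 0 by rewrite mulf_neq0// subr_eq0.
  apply: (scalerI n0); rewrite scalerA [_ * (p / _)]mulrC divfK//.
  have -> : p *: G t = c *: (lam t *: F) + lam t *: (c *: F) - lam t *: F.
    by rewrite E addrK.
  by rewrite !scalerA -!scalerDl -scalerBl; congr (_ *: _); ring.
have [[x Fi] [y Fj]] := (FE i, FE j).
move/eqP: K0; apply; rewrite /cubic_commutator Fi Fj.
by rewrite -!scalemxAl -!scalemxAr !scalerA mulrC subrr.
Qed.

End rigidity.

Lemma pos_def1 (R : realType) (n : nat) : pos_def (1%:M : 'M[R]_n).
Proof.
move=> v v0; rewrite mulmx1 mxE.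
have [k vk] : exists k, v 0 k != 0.
  apply: contrapT => nex; move/eqP: v0; apply; apply/matrixP => a k.
  by rewrite ord1 mxE; apply/eqP; apply: contrapT => /negP vk; apply: nex; exists k.
rewrite (bigD1 k)//= mxE -expr2 ltr_pwDl ?exprn_even_gt0//.
by apply: sumr_ge0 => l _; rewrite mxE -expr2 sqr_ge0.
Qed.

Lemma pos_def_sqr (R : realType) (n : nat) (A : 'M[R]_n) :
  A^T = A -> A \in unitmx -> pos_def (A *m A).
Proof.
move=> AT uA v v0; have vA0 : v *m A != 0.
  by apply: contra_neq v0 => vA; rewrite -(mulmxK uA v) vA mul0mx.
have := pos_def1 vA0; rewrite mulmx1 trmx_mul AT.
by rewrite !mulmxA.
Qed.

Section alpha_levi_civita.
Context (R : realType) (d : nat) (U : set 'rV[R]_d) (G : metric R d).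
Hypothesis oU : open U.
Hypothesis rG : riemannian_metric U G.
Hypothesis codazzi : forall i j k t, U t ->
  partial i (fun u => G u j k) t = partial j (fun u => G u i k) t.

Let sG : smooth_mx U G. Proof. by case: rG. Qed.
Let symG t : U t -> (G t)^T = G t. Proof. by case: rG => _ /[apply] -[]. Qed.
Let uG t : U t -> G t \in unitmx.
Proof. by case: rG => _ /[apply] -[_]; exact: pos_def_unitmx. Qed.

Section first_kind.
Variables (c : R) (Gamma1 : 'I_d -> 'I_d -> 'I_d -> 'rV[R]_d -> R).
Hypothesis Gamma1E : forall i j k t, U t ->
  Gamma1 i j k t = c * partial i (fun u => G u j k) t.

Let Gamma i j k t := \sum_(l < d) Gamma1 i j l t * invmx (G t) l k.

Lemma christoffel_mx_cubic i t : U t ->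
  christoffel_mx Gamma i t = c *: mx_partial i G t *m invmx (G t).
Proof.
move=> Ut; rewrite first_kind_christoffel_mx; congr (_ *m _).
by apply/matrixP => j k; rewrite !mxE Gamma1E.
Qed.

Lemma torsion_free_cubic : torsion_free U (connection_of_first_kind G Gamma1).
Proof.
apply: torsion_free_connection_of => i j k t Ut; apply: eq_bigr => l _.
by rewrite !Gamma1E// codazzi.
Qed.

(** For [c = 0], [1/2], [1] the right-hand side is the derivative of [g = 1],
    [g = G], [g = G^2] respectively. *)
Lemma compatible_cubicP g : smooth_mx U g ->
  compatible U (connection_of_first_kind G Gamma1) g <->
  forall i t, U t -> mx_partial i g t =
    c *: (mx_partial i G t *m invmx (G t) *m g t +
          g t *m invmx (G t) *m mx_partial i G t).
Proof.
move=> sg; rewrite (compatible_connection_of _ oU sg).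
have E i t : U t -> christoffel_mx Gamma i t *m g t +
    g t *m (christoffel_mx Gamma i t)^T =
    c *: (mx_partial i G t *m invmx (G t) *m g t +
          g t *m invmx (G t) *m mx_partial i G t).
  move=> Ut; rewrite (christoffel_mx_cubic i Ut) -scalemxAl linearZ /= trmx_mul.
  rewrite trmx_inv (symG Ut) (mx_partial_sym oU symG i Ut).
  by rewrite -scalemxAl -scalemxAr -scalerDr !mulmxA.
by split=> H i t Ut; rewrite H// E.
Qed.

End first_kind.

(** Total symmetry of [d_i G_jk] reduces Koszul's formula to
    [Gamma_{ij,k} = d_i G_jk / 2], which makes the Levi-Civita connection the
    case [c = 1/2] of [curvature_mxE]. *)
Lemma flat_of_cubic_commutator0 :
  (forall i j t, U t -> cubic_commutator G i j t = 0) -> flat U G.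
Proof.
move=> K0 t Ut i j k; rewrite curvature_coord.
have GE a b e u : U u ->
    (partial a (fun u => G u b e) u + partial b (fun u => G u a e) u
     - partial e (fun u => G u a b) u) / 2 =
    2^-1 * partial a (fun u => G u b e) u.
  move=> Uu; rewrite (codazzi b a e Uu).
  have -> : partial e (fun u => G u a b) u = partial a (fun u => G u b e) u.
    rewrite (codazzi e a b Uu); apply: eq_partial oU Uu _ => w Uw.
    by have /matrixP/(_ b e) := symG Uw; rewrite mxE.
  by rewrite addrK mulrC.
rewrite (curvature_mxE oU sG uG (christoffel_mx_cubic GE) i j Ut) K0// mul0mx.
by rewrite scaler0; apply/matrixP => a b; rewrite !mxE.
Qed.

Lemma levi_civita_euclidean Gamma1 :
  (forall i j k t, U t -> Gamma1 i j k t = 0) ->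
  is_levi_civita U (connection_of_first_kind G Gamma1) (@euclidean_metric R d).
Proof.
move=> G0.
have G0E i j k t : U t -> Gamma1 i j k t = 0 * partial i (fun u => G u j k) t.
  by move=> Ut; rewrite G0// mul0r.
have s1 : smooth_mx U (@euclidean_metric R d) by exact: smooth_mx_cst.
split; [split=> // t _|exact: torsion_free_cubic G0E|].
  by split; [exact: trmx1|exact: pos_def1].
apply/(compatible_cubicP G0E s1) => i t Ut.
by rewrite scale0r mx_partial_cst.
Qed.

Lemma levi_civita_metric Gamma1 :
  (forall i j k t, U t ->
    Gamma1 i j k t = 2^-1 * partial i (fun u => G u j k) t) ->
  is_levi_civita U (connection_of_first_kind G Gamma1) G.
Proof.
move=> G1; split=> //; first exact: torsion_free_cubic G1.
apply/(compatible_cubicP G1 sG) => i t Ut.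
rewrite mulmxKV ?uG// mulmxV ?uG// mul1mx -mulr2n.
rewrite -(scaler_nat 2 (mx_partial i G t)) scalerA.
by rewrite mulVf ?scale1r// pnatr_eq0.
Qed.

Lemma levi_civita_sqr Gamma1 H :
  (forall t, U t -> H t = G t) ->
  (forall i j k t, U t ->
    Gamma1 i j k t = partial i (fun u => G u j k) t) ->
  is_levi_civita U (connection_of_first_kind G Gamma1) (fun t => H t *m H t).
Proof.
move=> HG G1.
have G1E i j k t : U t -> Gamma1 i j k t = 1 * partial i (fun u => G u j k) t.
  by move=> Ut; rewrite G1// mul1r.
have sH : smooth_mx U H by apply: (eq_smooth_mx oU _ sG) => t /HG.
have sHH := smooth_mxM oU sH sH.
split; [split=> // t Ut|exact: torsion_free_cubic G1E|].
  rewrite HG//; split; first by rewrite trmx_mul symG.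
  by apply: pos_def_sqr; [exact: symG|exact: uG].
apply/(compatible_cubicP G1E sHH) => i t Ut.
rewrite (mx_partialM i sH sH Ut) (eq_mx_partial i oU Ut HG) scale1r HG//.
by rewrite !mulmxA mulmxKV ?uG// mulmxK ?uG.
Qed.

End alpha_levi_civita.

(** * Exponential families *)

Section exponential_family.
Context (R : realType) (n d : nat) (Theta : set 'rV[R]_d).
Context (p : sample R n -> 'rV[R]_d -> R) (h : sample R n -> R).
Context (phi : sample R n -> 'rV[R]_d) (F : 'rV[R]_d -> R).
Hypothesis oT : open Theta.
Hypothesis p_exp : exponential_family Theta p h phi F.
Hypothesis p_reg : regular_model Theta p.

Lemma density_gt0 x t : Theta t -> 0 < p x t.
Proof. by move=> Tt; rewrite p_exp// expR_gt0. Qed.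

Lemma loglikE x t : Theta t ->
  loglik p x t = h x + \sum_(i < d) t 0 i * phi x 0 i - F t.
Proof. by move=> Tt; rewrite /loglik p_exp// expRK. Qed.

Lemma smooth_loglik x : smooth_on Theta (loglik p x).
Proof.
by apply: smooth_ln => //; [exact: regular_smooth p_reg x|exact: density_gt0].
Qed.

Lemma smooth_affine x :
  smooth_on Theta (fun t => h x + \sum_(i < d) t 0 i * phi x 0 i).
Proof.
apply: smoothD => //; first exact: smooth_cst.
apply: smooth_sum => // i; apply: smoothM => //; first exact: smooth_coord.
exact: smooth_cst.
Qed.

(** Each sample point expresses [F] through the smooth function [loglik p x]; any
    one of them will do. *)
Lemma smooth_potential : smooth_on Theta F.
Proof.
pose x0 : sample R n := [tuple of nseq n (0 : R)].
apply: (eq_smooth oT (f := fun t =>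
  (h x0 + \sum_(i < d) t 0 i * phi x0 0 i) + -1 * loglik p x0 t)).
  by move=> t Tt; rewrite loglikE//; ring.
apply: smoothD => //; first exact: smooth_affine.
by apply: smoothM => //; [exact: smooth_cst|exact: smooth_loglik].
Qed.

Definition score (x : sample R n) (j : 'I_d) (t : 'rV[R]_d) : R := phi x 0 j - partial j F t.

Lemma smooth_score x j : smooth_on Theta (score x j).
Proof.
apply: (eq_smooth oT (f := fun t => phi x 0 j + -1 * partial j F t)).
  by move=> t _; rewrite mulN1r.
apply: smoothD => //; first exact: smooth_cst.
apply: smoothM => //; first exact: smooth_cst.
exact/smooth_partial/smooth_potential.
Qed.

Lemma partial_score x i j t : Theta t ->
  partial i (score x j) t = - partial i (partial j F) t.
Proof.
move=> Tt; have dF := smooth_differentiable (smooth_partial j smooth_potential) Tt.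
rewrite (partialD i (f := fun=> _)); [|exact: differentiable_cst|exact: differentiableN].
by rewrite partial_cst add0r partialN.
Qed.

Lemma partial_loglik x i t : Theta t -> partial i (loglik p x) t = score x i t.
Proof.
move=> Tt; rewrite (eq_partial i oT Tt (loglikE x)).
have dA := smooth_differentiable (smooth_affine x) Tt.
have dF := smooth_differentiable smooth_potential Tt.
rewrite (partialD i dA); last exact: differentiableN.
rewrite (partialN i dF) /score; congr (_ - _).
have dS k : differentiable (fun u : 'rV[R]_d => u 0 k * phi x 0 k) t.
  by apply: differentiableM; [exact: differentiable_coord|exact: differentiable_cst].
rewrite partialD; [|exact: differentiable_cst|].
  rewrite partial_cst add0r.
  rewrite (_ : (fun u => _) =
    \sum_(k < d) (fun u : 'rV[R]_d => u 0 k * phi x 0 k)); last first.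
    by apply/funext => u; rewrite fct_sumE.
  rewrite /partial derive_sum; last by move=> k; exact: diff_derivable.
  rewrite (bigD1 i)//= big1 ?addr0.
    rewrite -[LHS]/(partial i _ t) partialM;
      [|exact: differentiable_coord|exact: differentiable_cst].
    by rewrite partial_coord partial_cst eqxx mul1r mulr0 addr0.
  move=> k ki; rewrite -[LHS]/(partial i _ t) partialM;
    [|exact: differentiable_coord|exact: differentiable_cst].
  by rewrite partial_coord partial_cst eq_sym (negbTE ki) mul0r mulr0 addr0.
rewrite (_ : (fun u => _) =
  \sum_(k < d) (fun u : 'rV[R]_d => u 0 k * phi x 0 k)); last first.
  by apply/funext => u; rewrite fct_sumE.
exact: differentiable_sum.
Qed.

Lemma partial2_loglik x i j t : Theta t ->
  partial i (partial j (loglik p x)) t = - partial i (partial j F) t.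
Proof.
move=> Tt; rewrite -(partial_score x i j Tt).
by apply: eq_partial oT Tt _ => u; exact: partial_loglik.
Qed.

Lemma partial_density x i t : Theta t ->
  partial i (p x) t = score x i t * p x t.
Proof.
move=> Tt; rewrite -partial_loglik// partial_ln//; last exact: density_gt0.
  by rewrite mulrC mulVKf// gt_eqF// density_gt0.
exact: smooth_differentiable (regular_smooth p_reg x) Tt.
Qed.

Let dp x t (Tt : Theta t) := smooth_differentiable (regular_smooth p_reg x) Tt.
Let ds x j t (Tt : Theta t) := smooth_differentiable (smooth_score x j) Tt.

Lemma partial2_density x i j t : Theta t -> partial i (partial j (p x)) t =
  (score x i t * score x j t - partial i (partial j F) t) * p x t.
Proof.
move=> Tt; apply: (etrans (eq_partial i oT Tt (partial_density x j))).
rewrite (partialM i (ds x j Tt) (dp x Tt)) (partial_score x i j Tt).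
rewrite (partial_density x i Tt).
move: (partial i (partial j F) t) (score x i t) (score x j t) (p x t) => Fij si sj q.
by ring.
Qed.

Lemma partial3_density x i j k t : Theta t ->
  partial i (partial j (partial k (p x))) t =
  (score x i t * score x j t * score x k t
   - partial j (partial k F) t * score x i t
   - partial i (partial j F) t * score x k t
   - partial i (partial k F) t * score x j t
   - partial i (partial j (partial k F)) t) * p x t.
Proof.
move=> Tt; apply: (etrans (eq_partial i oT Tt (partial2_density x j k))).
have dFjk := smooth_differentiable
  (smooth_partial j (smooth_partial k smooth_potential)) Tt.
have dss := differentiableM (ds x j Tt) (ds x k Tt).
rewrite (partialM i _ (dp x Tt)); last exact: differentiableB.
rewrite (partialD i dss); last exact: differentiableN.
rewrite (partialM i (ds x j Tt) (ds x k Tt)).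
rewrite (partialN i dFjk).
rewrite (partial_score x i j Tt) (partial_score x i k Tt) (partial_density x i Tt).
move: (partial i (partial j (partial k F)) t) (partial j (partial k F) t).
move: (partial i (partial j F) t) (partial i (partial k F) t) => Fij Fik Fijk Fjk.
move: (score x i t) (score x j t) (score x k t) (p x t) => si sj sk q.
by ring.
Qed.

Local Notation mu := (lebesgue_Rn R n).

(** Every derivative of the constant [\int p = 1] vanishes. *)
Lemma Rintegral_partials s t : Theta t ->
  \int[mu]_x partials s (p x) t = (s == [::])%:R.
Proof.
elim: s t => [|i s IHs] t Tt.
  by have [_ _ p1] := regular_density p_reg Tt; rewrite /Rintegral/= p1.
rewrite -(regular_diff_int p_reg s i Tt) (eq_partial i oT Tt IHs).
exact: partial_cst.
Qed.

(** A pair [(a, s)] stands for [a * partials s p]; by [Rintegral_partials] only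
    the multiples of [p] itself contribute to the integral. *)
Lemma Rintegral_combination (r : seq (R * seq 'I_d)) t : Theta t ->
  mu.-integrable setT (fun x => (\sum_(a <- r) a.1 * partials a.2 (p x) t)%:E) /\
  \int[mu]_x (\sum_(a <- r) a.1 * partials a.2 (p x) t) =
    \sum_(a <- r | a.2 == [::]) a.1.
Proof.
move=> Tt; elim: r => [|[c s] r [intr IHr]].
  under eq_fun do rewrite big_nil; split; first exact: integrable0.
  under eq_Rintegral do rewrite big_nil.
  by rewrite Rintegral_cst// mul0r big_nil.
have ints := regular_integrable p_reg s Tt.
have intcs : mu.-integrable setT (fun x => (c * partials s (p x) t)%:E).
  by have := integrableZl measurableT c ints.
under eq_fun do rewrite big_cons; split.
  by have := integrableD measurableT intcs intr.
under eq_Rintegral do rewrite big_cons /=.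
rewrite RintegralD// RintegralZl// IHr Rintegral_partials// big_cons /=.
by case: eqP; rewrite ?mulr1// mulr0 add0r.
Qed.

(** The expectation of a polynomial in the score is read off from its expression
    in terms of the derivatives of [p]. *)
Lemma expectation_combination (r : seq (R * seq 'I_d)) (f : sample R n -> R) t :
  Theta t ->
  (forall x, f x * p x t = \sum_(a <- r) a.1 * partials a.2 (p x) t) ->
  Defs.expectation p t f = \sum_(a <- r | a.2 == [::]) a.1.
Proof.
move=> Tt fE; rewrite -(Rintegral_combination r Tt).2.
by apply: eq_Rintegral => x _; exact: fE.
Qed.

Lemma fisher_rao_hessian t : Theta t -> fisher_rao p t = hessian F t.
Proof.
move=> Tt; apply/matrixP => i j; rewrite !mxE.
rewrite (expectation_combination
  (r := [:: (1, [:: i; j]); (partial i (partial j F) t, [::])])) //.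
  by rewrite !big_cons big_nil /= addr0.
move=> x; rewrite !big_cons big_nil /= (partial2_density x i j Tt).
rewrite (partial_loglik x i Tt) (partial_loglik x j Tt).
move: (partial i (partial j F) t) (score x i t) (score x j t) => Fij si sj.
by ring.
Qed.

(** The term [- d_i d_j F] has expectation zero against the score, and
    [d_i d_j d_k F] is the third moment of the score. *)
Lemma alpha_christoffelE alpha i j k t : Theta t ->
  alpha_christoffel p alpha i j k t =
  (1 - alpha) / 2 * partial i (fun u => fisher_rao p u j k) t.
Proof.
move=> Tt.
have GE u : Theta u -> fisher_rao p u j k = partial j (partial k F) u.
  by move=> Tu; rewrite fisher_rao_hessian// mxE.
rewrite (eq_partial i oT Tt GE); set c := (1 - alpha) / 2.
pose F2 a b := partial a (partial b F) t.
rewrite /alpha_christoffel (expectation_combination (r := [::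
    (c, [:: i; j; k]); (c * F2 i k, [:: j]); (c * F2 j k, [:: i]);
    (c * F2 i j - F2 i j, [:: k]);
    (c * partial i (partial j (partial k F)) t, [::])]))//.
  by rewrite !big_cons big_nil /= addr0.
move=> x; rewrite !big_cons big_nil /= (partial2_loglik x i j Tt).
rewrite (partial_loglik x i Tt) (partial_loglik x j Tt) (partial_loglik x k Tt).
rewrite (partial3_density x i j k Tt) (partial_density x i Tt).
rewrite (partial_density x j Tt) (partial_density x k Tt) -/(F2 i j) -/(F2 i k).
rewrite -/(F2 j k) -/c; move: (F2 i j) (F2 i k) (F2 j k) => Fij Fik Fjk.
move: (partial i (partial j (partial k F)) t) (score x i t) (score x j t).
move: (score x k t) (p x t) c => sk q c' Fijk si sj.
by ring.
Qed.

Lemma fisher_rao_codazzi i j k t : Theta t ->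
  partial i (fun u => fisher_rao p u j k) t =
  partial j (fun u => fisher_rao p u i k) t.
Proof.
move=> Tt.
have GE a b u : Theta u -> fisher_rao p u a b = partial a (partial b F) u.
  by move=> Tu; rewrite fisher_rao_hessian// mxE.
rewrite (eq_partial i oT Tt (GE j k)) (eq_partial j oT Tt (GE i k)).
exact: partialC oT (smooth_partial k smooth_potential) Tt.
Qed.

Lemma fisher_rao_riemannian : riemannian_metric Theta (fisher_rao p).
Proof.
have sF := smooth_potential.
split=> [i j|t Tt].
  apply: (eq_smooth oT (f := partial i (partial j F))).
    by move=> t Tt; rewrite fisher_rao_hessian// mxE.
  exact/smooth_partial/smooth_partial.
split; last exact: regular_pos_def p_reg _ Tt.
rewrite fisher_rao_hessian//; apply/matrixP => i j.
by rewrite [LHS]mxE [LHS]mxE [RHS]mxE; exact: partialC oT sF Tt.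
Qed.

End exponential_family.

Theorem proposition4p16 (R : realType) (n d : nat)
    (Theta : set 'rV[R]_d) (p : sample R n -> 'rV[R]_d -> R)
    (h : sample R n -> R) (phi : sample R n -> 'rV[R]_d) (F : 'rV[R]_d -> R)
    (alpha : R)
    (Theta_open : open Theta)
    (p_exp : exponential_family Theta p h phi F)
    (p_reg : regular_model Theta p)
    (not_flat : ~ flat Theta (fisher_rao p))
    (dim2 : d = 2%N) :
  [/\ alpha = 1 ->
        is_levi_civita Theta (alpha_connection p alpha) (@euclidean_metric R d),
      alpha = 0 ->
        is_levi_civita Theta (alpha_connection p alpha) (fisher_rao p),
      alpha = -1 ->
        is_levi_civita Theta (alpha_connection p alpha)
          (fun t => hessian F t *m hessian F t) &
      alpha != 1 -> alpha != 0 -> alpha != -1 ->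
        ~ exists g : metric R d,
          riemannian_metric Theta g /\
          compatible Theta (alpha_connection p alpha) g].
Proof.
have rG := fisher_rao_riemannian Theta_open p_exp p_reg.
have cod := fisher_rao_codazzi Theta_open p_exp p_reg.
have GammaE := alpha_christoffelE Theta_open p_exp p_reg alpha.
have [sG Gt] := rG.
split=> [a1|a0|aN1|a1 a0 aN1 [g [rg comp]]].
- apply: levi_civita_euclidean => // i j k t Tt.
  by rewrite GammaE// a1 subrr !mul0r.
- apply: levi_civita_metric => // i j k t Tt.
  by rewrite GammaE// a0 subr0 mul1r.
- apply: levi_civita_sqr rG cod _ _ _ _ => // [t Tt|i j k t Tt].
    by rewrite (fisher_rao_hessian Theta_open p_exp p_reg).
  by rewrite GammaE// aN1 opprK divff ?mul1r// pnatr_eq0.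
- apply: not_flat; apply: flat_of_cubic_commutator0 => // i j t Tt.
  subst d.
  have uG u : Theta u -> fisher_rao p u \in unitmx.
    by move=> /Gt[_]; exact: pos_def_unitmx.
  apply: (compatible_cubic_commutator0 (c := (1 - alpha) / 2) Theta_open sG _ uG
    (christoffel_mx_cubic GammaE) _ _ _ rg comp) => //.
  + by move=> u /Gt[].
  + by rewrite mulf_neq0// ?invr_eq0 ?pnatr_eq0// subr_eq0 eq_sym.
  + by apply: contra_neq aN1 => ?; lra.
  + by apply: contra_neq a0 => ?; lra.
Qed.
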